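(* Let $\phi=(\sqrt5+1)/2$ and let $$S=\{t\in(0,1)\setminus\mathbb{Q}:\ a_{i+1}(t)\ge \phi^{d_i(t)}\ \text{ for infinitely many } i\}.$$ Then $S$ is an uncountable set of (Lebesgue) measure zero and, if $t\in S$ and $y=\exp(2\pi i t)$, then the continued fraction $K(y)$ diverges.
   Context: For irrational $t\in(0,1)$, $[0,a_1(t),a_2(t),\dots]$ denotes the regular continued fraction expansion of $t$, and $c_i(t)/d_i(t)$ denotes its $i$-th convergent in lowest terms (so $c_0/d_0=0/1$, $c_1/d_1=1/a_1$, and $d_{i+1}=a_{i+1}d_i+d_{i-1}$). For $x\in\mathbb{C}$, $K(x)$ is the continued fraction $$K(x)=1+\cfrac{x}{1+\cfrac{x^2}{1+\cfrac{x^3}{1+\ddots}}}.$$ Its $n$-th convergent is $K_n(x)=P_n(x)/Q_n(x)$, where $P_0=1$, $P_1=1+x$, $Q_0=Q_1=1$, and $P_{n+1}(x)=P_n(x)+x^{n+1}P_{n-1}(x)$, $Q_{n+1}(x)=Q_n(x)+x^{n+1}Q_{n-1}(x)$ for $n\ge1$. The continued fraction $K(x)$ converges if the sequence $P_n(x)/Q_n(x)$ has a limit in $\hat{\mathbb{C}}=\mathbb{C}\cup\{\infty\}$, and diverges otherwise. *)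

(* Defs.v *)
From HB Require Import structures.
From mathcomp Require Import all_boot all_order all_algebra.
From mathcomp Require Import complex.
From mathcomp Require Import all_classical all_reals all_analysis.

Set Implicit Arguments.
Unset Strict Implicit.
Unset Printing Implicit Defensive.

Import Order.TTheory GRing.Theory Num.Theory.
Import numFieldNormedType.Exports.

Local Open Scope classical_set_scope.
Local Open Scope ring_scope.
Local Open Scope complex_scope.

Section regular_continued_fraction.
Variable R : realType.
Implicit Type t : R.

Definition gauss_map t : R := t^-1 - (Num.truncn t^-1)%:R.

(* [cf_digit t i] is a_i(t) in t = [0, a_1(t), a_2(t), ...], for t irrational
   in ]0, 1[; in particular a_0(t) = 0. *)
Definition cf_digit t (i : nat) : nat :=
  if i is j.+1 then Num.truncn (iter j gauss_map t)^-1 else 0%N.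

(* [:: b_0; ...; b_n] |-> b_0 + 1/(b_1 + 1/(... + 1/b_n)). Since 0^-1 = 0, the
   innermost step b_n + 0^-1 is b_n; no other inverse of 0 occurs when
   b_1, ..., b_n are positive. *)
Definition finite_cf (s : seq nat) : rat := foldr (fun b v => b%:R + v^-1) 0 s.

Definition cf_convergent t (i : nat) : rat := finite_cf (mkseq (cf_digit t) i.+1).

(* d_i(t): [denq] is the positive denominator in lowest terms. *)
Definition cf_denominator t (i : nat) : nat := `|denq (cf_convergent t i)|%N.

Definition golden_ratio : R := (Num.sqrt 5 + 1) / 2.

Definition exceptional_set : set R :=
  [set t | [/\ 0 < t < 1, irrational t &
    infinite_set [set i : nat |
      (cf_digit t i.+1)%:R >= golden_ratio ^+ cf_denominator t i]]].

End regular_continued_fraction.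

Section rogers_ramanujan_continued_fraction.
Variable R : realType.
Implicit Type x z : R[i].

Fixpoint K_num x (n : nat) : R[i] :=
  match n with
  | 0 => 1
  | 1 => 1 + x
  | (m.+1 as n').+1 => K_num x n' + x ^+ n * K_num x m
  end.

Fixpoint K_den x (n : nat) : R[i] :=
  match n with
  | 0 | 1 => 1
  | (m.+1 as n').+1 => K_den x n' + x ^+ n * K_den x m
  end.

(* The Riemann sphere, with None as the point at infinity; (R[i])^o carries the
   topology of the complex modulus. *)
Definition riemann_sphere := one_point_compactification (R[i])^o.
HB.instance Definition _ := Topological.on riemann_sphere.
HB.instance Definition _ := Pointed.on riemann_sphere.

(* P_n(x) and Q_n(x) never vanish together: for x != 0 because
   P_n Q_(n-1) - P_(n-1) Q_n = +- x ^ (n (n + 1) / 2), and Q_n(0) = 1. *)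
Definition K_convergent x (n : nat) : riemann_sphere :=
  if K_den x n == 0 then None else Some (K_num x n / K_den x n).

Definition K_converges x : Prop := cvg (K_convergent x @ \oo).

Definition K_diverges x : Prop := ~ K_converges x.

Definition cexp z : R[i] :=
  (expR (complex.Re z))%:C *
  (cos (complex.Im z) +i* sin (complex.Im z)).

End rogers_ramanujan_continued_fraction.

(* Main.v *)
Require Import Defs.
From mathcomp Require Import all_boot all_order all_algebra.
From mathcomp Require Import complex.
From mathcomp Require Import all_classical all_reals all_analysis.
From mathcomp Require Import ring lra zify.

Set Implicit Arguments.
Unset Strict Implicit.
Unset Printing Implicit Defensive.

Import Order.TTheory GRing.Theory Num.Theory.
Import numFieldNormedType.Exports.
Import ComplexField.Normc.

Local Open Scope classical_set_scope.
Local Open Scope ring_scope.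
Local Open Scope complex_scope.

(** Divergence.  Let W_n be the matrix with rows (P_n, P_(n-1)) and
    (Q_n, Q_(n-1)).  On the unit circle its determinant has modulus 1, so
    consecutive convergents are at distance at least a constant times
    1 / (|(P_n, Q_n)| |(P_(n-1), Q_(n-1))|) on the Riemann sphere.  Hence K(y)
    diverges as soon as the four entries of W_n are bounded along some
    infinite set of n ([K_diverges_bounded]).

    At a primitive m-th root of unity x, all entries of W_(m-1) have modulus at
    most 2 ([K_bounds_prim_root]), for three reasons.  First, the trace
    P_(m-1) + Q_(m-2) is 1: with a formal variable z inserted in each partial
    numerator, z x^k instead of x^k, the trace becomes a polynomial T(z) of
    degree at most m/2, and T(x z) = T(z) since z -> x z permutes the m
    factors of the trace cyclically; so only the constant coefficient of T
    survives ([trace_prim_root]).  Second, reading the partial numerators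
    backwards replaces x^k by x^(m-k), the conjugate of x^k; a continuant is
    invariant under reversal, so P_(m-1) is real and P_(m-2) is the conjugate of
    Q_(m-1).  Third, the determinant has modulus 1.  Writing a = P_(m-1) and
    b = Q_(m-1) these say that |a (1 - a) - |b|^2| = 1, which bounds a and b.

    For t exceptional, y = exp(2 pi i t) is so close to the root of unity
    exp(2 pi i c_i / d_i), at distance at most 4 pi / (d_i^2 phi^d_i) for
    infinitely many i, that the bound at the root of unity persists at y: on
    the unit circle P_n and Q_n are Lipschitz with constants
    (n+1)^2 phi^(n+1) and n^2 phi^n ([K_num_lip], [K_den_lip]), because
    their recurrence is dominated by that of the Fibonacci numbers.

    Measure.  An exceptional t lies within 1 / (q^2 phi^q) of a fraction p/q,
    0 <= p <= q, for arbitrarily large q.  For each q these neighbourhoods have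
    total length at most 4 / phi^q, so Borel-Cantelli applies.

    Uncountability.  Every sequence of positive integers is the digit sequence of
    an irrational number, found in a nested intersection of intervals
    ([in_cylinders_ex], [in_cylinders_digit]).  Given a sequence of real
    numbers, choose the digits one after the other, each larger than phi^d_i,
    the i-th one different from the i-th digit of the i-th number: the result is
    exceptional and outside the sequence. *)

(** * Continuants *)

Lemma nat_ind2 (P : nat -> Prop) :
  P 0%N -> P 1%N -> (forall n, P n -> P n.+1 -> P n.+2) -> forall n, P n.
Proof.
move=> P0 P1 IH n; suff [] : P n /\ P n.+1 by [].
by elim: n => [|n [Pn Pn1]]; split=> //; apply: IH.
Qed.

(** The Euler-Wallis continuant of order n of the partial numerators
    w 0, ..., w (n - 2), all partial denominators being 1. *)
Fixpoint continuant (A : comNzRingType) (w : nat -> A) (n : nat) : A :=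
  match n with
  | 0 | 1 => 1
  | (m.+1 as n').+1 => continuant w n' + w m * continuant w m
  end.

Lemma continuantSS (A : comNzRingType) (w : nat -> A) n :
  continuant w n.+2 = continuant w n.+1 + w n * continuant w n.
Proof. by []. Qed.

Lemma continuant_front (A : comNzRingType) (w : nat -> A) n :
  continuant w n.+2 =
    continuant (fun k => w k.+1) n.+1 + w 0%N * continuant (fun k => w k.+2) n.
Proof.
elim/nat_ind2: n => [//||n IHn IHn1]; first by rewrite /=; ring.
rewrite continuantSS IHn1 IHn (continuantSS _ n.+1) (continuantSS (fun k => w k.+2) n).
by ring.
Qed.

(** The recurrences at the two ends of a continuant exchange roles under
    reversal of its partial numerators. *)
Lemma continuant_rev (A : comNzRingType) n (v w : nat -> A) :
  (forall k, (k.+2 <= n)%N -> v k = w (n - k.+2)%N) -> continuant v n = continuant w n.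
Proof.
elim/nat_ind2: n v => [//|//|n IHn IHn1] v vw.
rewrite continuant_front continuantSS vw // subSS subSS subn0.
congr (_ + _ * _); last by apply: IHn => k kn; rewrite vw // subSS subSS.
by apply: IHn1 => k kn; rewrite vw // !subSS.
Qed.

Lemma eq_continuant (A : comNzRingType) n (v w : nat -> A) :
  v =1 w -> continuant v n = continuant w n.
Proof. by move=> vw; elim/nat_ind2: n => // n IHn IHn1; rewrite !continuantSS IHn1 IHn vw. Qed.

Lemma rmorph_continuant (A B : comNzRingType) (f : {rmorphism A -> B}) w n :
  f (continuant w n) = continuant (f \o w) n.
Proof.
elim/nat_ind2: n => [||n IHn IHn1]; rewrite ?rmorph1 //.
by rewrite !continuantSS rmorphD rmorphM IHn IHn1.
Qed.

Lemma coef_comp_scaleX (A : comNzRingType) (p : {poly A}) (a : A) k :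
  (p \Po (a *: 'X))`_k = a ^+ k * p`_k.
Proof.
elim/poly_ind: p k => [|p c IHp] k; first by rewrite comp_poly0 !coef0 mulr0.
rewrite comp_poly_MXaddC !coefD -scalerAr coefZ !coefMX !coefC.
by case: k => [|k] /=; [rewrite mulr0 expr0; ring | rewrite IHp exprS; ring].
Qed.

(** * The trace at a root of unity *)

Section trace.
Variables (F : fieldType) (x : F).

(** The continuant of z x^j, z x^(j+1), ..., with z an indeterminate: it keeps
    track of how many partial numerators occur in each monomial. *)
Definition pcontinuant (j n : nat) : {poly F} := continuant (fun k => x ^+ (j + k) *: 'X) n.

Lemma size_pcontinuant j n : (size (pcontinuant j n) <= n./2.+1)%N.
Proof.
rewrite /pcontinuant; elim/nat_ind2: n => [||n IHn IHn1]; rewrite ?size_poly1 //.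
rewrite continuantSS (leq_trans (size_polyD _ _)) // geq_max; apply/andP; split.
  by apply: (leq_trans IHn1); rewrite ltnS half_leq.
rewrite -scalerAl (leq_trans (size_scale_leq _ _)) //.
by rewrite (leq_trans (size_polyMleq _ _)) // size_polyX.
Qed.

Lemma pcontinuant_comp j n : pcontinuant j n \Po (x *: 'X) = pcontinuant j.+1 n.
Proof.
rewrite /pcontinuant (rmorph_continuant (comp_poly (x *: 'X))); apply: eq_continuant => k /=.
by rewrite comp_polyZ comp_polyX scalerA -exprSr addSn.
Qed.

Lemma horner_pcontinuant j n : (pcontinuant j n).[1] = continuant (fun k => x ^+ (j + k)) n.
Proof.
rewrite /pcontinuant -/(horner_eval 1 _) rmorph_continuant; apply: eq_continuant => k /=.
by rewrite /horner_eval hornerZ hornerX mulr1.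
Qed.

Lemma horner0_pcontinuant j n : (pcontinuant j n).[0] = 1.
Proof.
rewrite /pcontinuant; elim/nat_ind2: n => [||n IHn IHn1]; rewrite ?hornerC //.
by rewrite continuantSS hornerD hornerM hornerZ hornerX mulr0 mul0r addr0.
Qed.

(** The trace P_(m-1) + Q_(m-2) as the value at z = 1 of a polynomial T.  The
    invariance T(x z) = T(z) reflects that T is the continuant of the cyclic
    arrangement of z x^0, ..., z x^(m-1). *)
Lemma trace_prim_root m : (1 < m)%N -> m.-primitive_root x ->
  continuant (fun k => x ^+ (1 + k)) m + continuant (fun k => x ^+ (2 + k)) (m - 2) = 1.
Proof.
case: m => [|[|m]] // _ xm; rewrite subn2 /=.
pose T := pcontinuant 1 m.+2 + 'X * pcontinuant 2 m.
have TE : T \Po (x *: 'X) = T.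
  rewrite /T rmorphD rmorphM /= comp_polyX !pcontinuant_comp.
  rewrite {1 3}/pcontinuant continuantSS continuant_front.
  have -> : x ^+ (2 + m) = 1 by rewrite (prim_expr_order xm).
  rewrite scale1r addn0 expr1.
  have shift a n : continuant (fun k => x ^+ (a + k.+1) *: 'X) n = pcontinuant a.+1 n.
    by apply: eq_continuant => k; rewrite addnS.
  rewrite shift; have -> : continuant (fun k => x ^+ (1 + k.+2) *: 'X) m = pcontinuant 3 m.
    by apply: eq_continuant => k; rewrite !addSn.
  rewrite -!/(pcontinuant _ _); ring.
(* Each monomial uses pairwise non-adjacent partial numerators, so at most m/2. *)
have szT : (size T <= m./2.+2)%N.
  rewrite (leq_trans (size_polyD _ _)) // geq_max size_pcontinuant /=.
  rewrite (leq_trans (size_polyMleq _ _)) // size_polyX.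
  exact: size_pcontinuant.
have T0 k : (0 < k)%N -> T`_k = 0.
  move=> k_gt0; have [kT|/leq_sizeP/(_ k (leqnn k))//] := ltnP k (size T).
  have /(congr1 (fun p : {poly F} => p`_k)) := TE.
  rewrite coef_comp_scaleX => /eqP.
  rewrite -subr_eq0 -[X in _ - X]mul1r -mulrBl mulf_eq0 => /orP[|/eqP//].
  rewrite subr_eq0 -(prim_order_dvd xm) => /(dvdn_leq k_gt0) mk.
  suff : (m./2.+1 < k)%N by rewrite ltnNge -ltnS (leq_trans kT szT).
  by apply: leq_trans mk; rewrite !ltnS leq_half_double -addnn -addnS leq_addr.
have T1 : T = 1.
  apply/polyP => -[|k]; last by rewrite T0 // coef1.
  by rewrite -horner_coef0 /T hornerD hornerM hornerX mul0r addr0 horner0_pcontinuant coef1.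
have /(congr1 (fun p : {poly F} => p.[1])) := T1.
by rewrite /T hornerD hornerM hornerX mul1r !horner_pcontinuant hornerC.
Qed.
End trace.

(** * The unit circle *)

Section cis.
Variable R : realType.
Implicit Types (a b : R) (z w : R[i]).

Definition cis a : R[i] := cos a +i* sin a.

Lemma cisD a b : cis (a + b) = cis a * cis b.
Proof. by apply/eqP; rewrite eq_complex /= cosD sinD [X in _ && (X == _)]addrC !eqxx. Qed.

Lemma cis0 : cis 0 = 1.
Proof. by rewrite /cis cos0 sin0. Qed.

Lemma cisMn a n : cis (a *+ n) = cis a ^+ n.
Proof. by elim: n => [|n IHn]; rewrite ?cis0 // mulrS cisD IHn exprS. Qed.

Lemma normc_cis a : normc (cis a) = 1.
Proof. by rewrite /= cos2Dsin2 sqrtr1. Qed.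

Lemma conjc_cis a : conjc (cis a) = (cis a)^-1.
Proof.
have -> : conjc (cis a) = cis (- a) by rewrite /cis cosN sinN.
by apply: (divr1_eq _); rewrite invrK -cisD addNr cis0.
Qed.

Lemma ler_normcD z w : normc (z + w) <= normc z + normc w.
Proof. exact: le_normcD. Qed.

Lemma normc_le_ReIm z : normc z <= `|complex.Re z| + `|complex.Im z|.
Proof.
case: z => a b /=; rewrite -[leRHS]ger0_norm ?addr_ge0 // -sqrtr_sqr ler_wsqrtr //.
rewrite sqrrD !real_normK ?num_real // addrAC lerDl.
by rewrite mulrn_wge0 // mulr_ge0.
Qed.

Lemma lip_cos a b : `|cos a - cos b| <= `|a - b|.
Proof.
wlog: a b / a <= b => [H|ab].
  have [|/ltW] := leP a b; first exact: H.
  by rewrite distrC (distrC a); exact: H.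
rewrite distrC (distrC a).
have [|c _ ->] := @MVT_segment R cos (fun x => - sin x) a b ab (fun x _ => is_derive_cos x).
  by apply: continuous_subspaceT => x; exact: continuous_cos.
by rewrite normrM ler_piMl // normrN sin_max.
Qed.

Lemma lip_sin a b : `|sin a - sin b| <= `|a - b|.
Proof.
wlog: a b / a <= b => [H|ab].
  have [|/ltW] := leP a b; first exact: H.
  by rewrite distrC (distrC a); exact: H.
rewrite distrC (distrC a).
have [|c _ ->] := @MVT_segment R sin cos a b ab (fun x _ => is_derive_sin x).
  by apply: continuous_subspaceT => x; exact: continuous_sin.
by rewrite normrM ler_piMl // cos_max.
Qed.

Lemma lip_cis a b : normc (cis a - cis b) <= 2 * `|a - b|.
Proof.
apply: (le_trans (normc_le_ReIm _)) => /=; rewrite mulr2n mulrDl mul1r.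
by apply: lerD; [exact: lip_cos | exact: lip_sin].
Qed.

(** The identity cos a = 1 - 2 (sin (a/2))^2, with a/2 in ]0, pi[. *)
Lemma cis_neq1 a : 0 < a < 2 * pi -> cis a != 1.
Proof.
move=> a2pi; apply/eqP => /(congr1 (@complex.Re R)) /=.
have -> : a = (a / 2) *+ 2 by rewrite -mulr_natr mulfVK.
rewrite cos_mulr2n cos2sin2 => h.
have : 0 < sin (a / 2) by apply: sin_gt0_pi; lra.
by nra.
Qed.

Lemma cis_prim_root (p q : nat) : (0 < q)%N -> coprime p q ->
  q.-primitive_root (cis (2 * pi * (p%:R / q%:R))).
Proof.
move=> q_gt0 pq; have q0 : (0 : R) < q%:R by rewrite ltr0n.
have -> : 2 * pi * (p%:R / q%:R) = (2 * pi / q%:R) *+ p :> R.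
  by rewrite -mulr_natr; ring.
rewrite cisMn prim_root_exp_coprime //.
apply/andP; split=> //; apply/forallP => -[i iq]; apply/eqP => /=.
rewrite unity_rootE -cisMn; have [->|neq] := eqVneq i.+1 q.
  rewrite -[_ *+ q]mulr_natr mulfVK ?lt0r_neq0 // mulr_natl.
  by rewrite /cis cos2pi sin2pi eqxx.
apply/negbTE/cis_neq1; rewrite -[_ *+ _]mulr_natr.
have ? : (0 : R) < pi := pi_gt0 R.
rewrite mulr_gt0 ?divr_gt0 ?mulr_gt0 ?ltr0n //=.
rewrite -mulrA gtr_pMr ?mulr_gt0 // ltr_pdivrMl // mulr1 ltr_nat.
by rewrite ltn_neqAle neq.
Qed.

Lemma cexp_cis a : cexp ((a)%:C * 'i%C) = cis a.
Proof. by rewrite /cexp /= !mul0r !mulr0 !mulr1 subr0 addr0 expR0 mul1r. Qed.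

End cis.

(** * Numerators and denominators on the unit circle *)

Section rr.
Variable R : realType.
Implicit Types (a b : R) (x y z w : R[i]).

Lemma normcX z n : normc (z ^+ n) = normc z ^+ n.
Proof. by elim: n => [|n IHn]; rewrite ?normc1 // !exprS normcM IHn. Qed.

Lemma normc_opp z : normc (- z) = normc z.
Proof. exact: normcN. Qed.

Lemma ler_normcB z w : normc (z - w) <= normc z + normc w.
Proof. by rewrite -(normc_opp w); exact: ler_normcD. Qed.

Lemma normc_ge0 z : 0 <= normc z.
Proof. by case: z => a b; exact: sqrtr_ge0. Qed.

Lemma normcR a : normc a%:C = `|a|.
Proof. by rewrite /= expr0n addr0 sqrtr_sqr. Qed.

Lemma K_numE x n : K_num x n = continuant (fun k => x ^+ (1 + k)) n.+1.
Proof.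
elim/nat_ind2: n => [||n IHn IHn1] //; first by rewrite /= mulr1.
by rewrite continuantSS -IHn -IHn1.
Qed.

Lemma K_denE x n : K_den x n = continuant (fun k => x ^+ (2 + k)) n.
Proof. by elim/nat_ind2: n => [||n IHn IHn1] //; rewrite continuantSS -IHn -IHn1. Qed.

(** Each step of the recurrence multiplies the determinant by - x^(n+2). *)
Lemma normc_K_det x n : normc x = 1 ->
  normc (K_num x n.+1 * K_den x n - K_num x n * K_den x n.+1) = 1.
Proof.
move=> x1; elim: n => [|n IHn]; first by rewrite /= !mulr1 addrC addKr.
have -> : K_num x n.+2 * K_den x n.+1 - K_num x n.+1 * K_den x n.+2 =
    - (x ^+ n.+2 * (K_num x n.+1 * K_den x n - K_num x n * K_den x n.+1)).
  have eP : K_num x n.+2 = K_num x n.+1 + x ^+ n.+2 * K_num x n by [].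
  have eQ : K_den x n.+2 = K_den x n.+1 + x ^+ n.+2 * K_den x n by [].
  rewrite eP eQ; move: (K_num x n.+1) (K_num x n) (K_den x n.+1) (K_den x n) (x ^+ _).
  by move=> *; ring.
by rewrite normc_opp normcM IHn normcX x1 expr1n mulr1.
Qed.

(** The entries P_(n+1), Q_n of the diagonal are real with sum 1, and the
    other two are conjugate.  The determinant r (1 - r) - |Q_(n+1)|^2, real of
    modulus 1, is thus at least -1; this inequality confines the entries. *)
Lemma K_bounds_prim_root a n : n.+2.-primitive_root (cis a) ->
  [/\ normc (K_num (cis a) n.+1) <= 2, normc (K_num (cis a) n) <= 2,
      normc (K_den (cis a) n.+1) <= 2 & normc (K_den (cis a) n) <= 2].
Proof.
set x := cis a => xn.
have x1 : normc x = 1 := normc_cis a.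
have x0 : x != 0.
  by apply/eqP => x0; move: x1; rewrite x0 normc0 => /esym/eqP; rewrite oner_eq0.
have conjX i j : (i + j)%N = n.+2 -> conjc (x ^+ i) = x ^+ j.
  move=> ij; have -> : conjc (x ^+ i) = conjc x ^+ i by exact: rmorphXn.
  rewrite (conjc_cis a : conjc x = x^-1).
  rewrite exprVn.
  by apply: (mulfI (expf_neq0 i x0)); rewrite mulfV ?expf_neq0 // -exprD ij prim_expr_order.
have tr : K_num x n.+1 + K_den x n = 1.
  by rewrite K_numE K_denE -[n in X in _ + X](subn2 n.+2); exact: trace_prim_root.
have Preal : conjc (K_num x n.+1) = K_num x n.+1.
  rewrite K_numE (rmorph_continuant (@conjc R)).
  by apply: continuant_rev => k kn; apply: conjX; lia.
have PQ : conjc (K_num x n) = K_den x n.+1.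
  rewrite K_numE K_denE (rmorph_continuant (@conjc R)).
  by apply: continuant_rev => k kn; apply: conjX; lia.
have [r Pr] : exists r, K_num x n.+1 = r%:C.
  case: (K_num x n.+1) Preal => u v [] uv; exists u; congr (_ +i* _); lra.
have Qr : K_den x n = (1 - r)%:C.
  rewrite -(addrK (K_num x n.+1) (K_den x n)) addrC [K_den _ _ + _]addrC.
  by rewrite tr Pr rmorphB rmorph1 addrC.
have sE : normc (K_num x n) = normc (K_den x n.+1).
  by rewrite -PQ; case: (K_num x n) => u v; rewrite /= sqrrN.
have PQn : K_num x n * K_den x n.+1 = (normc (K_num x n) ^+ 2)%:C.
  rewrite -PQ; case: (K_num x n) => u v /=; rewrite sqr_sqrtr ?addr_ge0 ?sqr_ge0 //.
  by apply/eqP; rewrite eq_complex /=; apply/andP; split; apply/eqP; ring.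
have := normc_K_det n x1; rewrite PQn Pr Qr -rmorphM -rmorphB normcR.
rewrite -sE; have s_ge0 := normc_ge0 (K_num x n).
rewrite !normcR; move: (normc (K_num x n)) s_ge0 => s s_ge0 /eqP.
rewrite eq_le => /andP[/ler_normlP[]]; rewrite opprB => h _ _.
have s2 : s <= 2 by have := sqr_ge0 (r - 2^-1); nra.
split=> //.
- by apply/ler_normlP; split; nra.
- by apply/ler_normlP; split; nra.
Qed.

Lemma golden_ratio_sqr : golden_ratio R ^+ 2 = golden_ratio R + 1.
Proof.
have : Num.sqrt (5 : R) ^+ 2 = 5 by rewrite sqr_sqrtr.
rewrite /golden_ratio; move: (Num.sqrt _) => s hs.
by rewrite exprMn sqrrD hs; field.
Qed.

Lemma golden_ratio_gt1 : 1 < golden_ratio R.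
Proof.
have := golden_ratio_sqr; have : 0 < golden_ratio R.
  by rewrite divr_gt0 // ltr_wpDl // sqrtr_ge0.
move: (golden_ratio R) => p; nra.
Qed.

Local Notation phi := (golden_ratio R).

Lemma golden_ratio_exprSS n : phi ^+ n.+2 = phi ^+ n.+1 + phi ^+ n.
Proof. by rewrite 2!exprSr -mulrA -expr2 golden_ratio_sqr mulrDr mulr1 -exprSr. Qed.

Lemma normc_continuant_le (v : nat -> R[i]) n : (forall k, normc (v k) <= 1) ->
  normc (continuant v n) <= phi ^+ n.
Proof.
move=> v1; elim/nat_ind2: n => [||n IHn IHn1]; rewrite ?normc1 //.
  by rewrite expr1 ltW // golden_ratio_gt1.
rewrite continuantSS golden_ratio_exprSS (le_trans (ler_normcD _ _)) // lerD //.
rewrite normcM; have := normc_ge0 (continuant v n); have := v1 n.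
by have := normc_ge0 (v n); nra.
Qed.

(** The error e (k + 2) made on the k-th partial numerator propagates along the
    Fibonacci-like recurrence; n^2 phi^n absorbs the errors added at all
    steps. *)
Lemma normc_continuantB_le (v w : nat -> R[i]) (e : R) n : 0 <= e ->
  (forall k, normc (v k) <= 1) -> (forall k, normc (w k) <= 1) ->
  (forall k, normc (v k - w k) <= k.+2%:R * e) ->
  normc (continuant v n - continuant w n) <= e * (n%:R ^+ 2 * phi ^+ n).
Proof.
move=> e_ge0 v1 w1 vw; elim/nat_ind2: n => [||n IHn IHn1].
- by rewrite subrr normc0 mulr_ge0 // mulr_ge0.
- by rewrite subrr normc0 !mulr_ge0 // exprn_ge0 // ltW // (lt_trans _ golden_ratio_gt1).
have -> : continuant v n.+2 - continuant w n.+2 = (continuant v n.+1 - continuant w n.+1) +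
    (v n * (continuant v n - continuant w n) + (v n - w n) * continuant w n).
  by rewrite !continuantSS; ring.
apply: (le_trans (ler_normcD _ _)).
have h2 : normc (v n * (continuant v n - continuant w n)) <= e * (n%:R ^+ 2 * phi ^+ n).
  by rewrite normcM -[leRHS]mul1r ler_pM // normc_ge0.
have h3 : normc ((v n - w n) * continuant w n) <= n.+2%:R * e * phi ^+ n.
  by rewrite normcM ler_pM ?normc_ge0 // normc_continuant_le.
have h23 := ler_normcD (v n * (continuant v n - continuant w n))
  ((v n - w n) * continuant w n).
have H : n.+1%:R ^+ 2 * phi ^+ n.+1 + n%:R ^+ 2 * phi ^+ n + n.+2%:R * phi ^+ n
    <= n.+2%:R ^+ 2 * phi ^+ n.+2.
  rewrite golden_ratio_exprSS !(natrD _ 2 n, natrD _ 1 n) (exprS phi n).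
  have f_ge0 : 0 <= phi ^+ n by rewrite exprn_ge0 // ltW // (lt_trans _ golden_ratio_gt1).
  have n_ge0 : (0 : R) <= n%:R by [].
  have p1 := golden_ratio_gt1.
  move: (n%:R : R) (phi) (phi ^+ n) n_ge0 p1 f_ge0 => N p f N0 p1 f0.
  have : 0 <= (p * (2 * N + 3) + (3 * N + 2)) * f by rewrite mulr_ge0 //; nra.
  by lra.
apply: (le_trans (lerD IHn1 (le_trans h23 (lerD h2 h3)))).
rewrite (_ : _ + _ = e * (n.+1%:R ^+ 2 * phi ^+ n.+1 + n%:R ^+ 2 * phi ^+ n +
  n.+2%:R * phi ^+ n)); last by ring.
by rewrite ler_wpM2l.
Qed.

Lemma normc_exprB_le x y n : normc x = 1 -> normc y = 1 ->
  normc (x ^+ n - y ^+ n) <= n%:R * normc (x - y).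
Proof.
move=> x1 y1; elim: n => [|n IHn]; first by rewrite subrr normc0 mul0r.
have -> : x ^+ n.+1 - y ^+ n.+1 = x * (x ^+ n - y ^+ n) + (x - y) * y ^+ n.
  by rewrite !exprS; ring.
rewrite (le_trans (ler_normcD _ _)) // !normcM normcX x1 y1 expr1n mulr1 mul1r.
by rewrite mulrSr mulrDl mul1r lerD2r.
Qed.

Lemma K_num_lip x y n : normc x = 1 -> normc y = 1 ->
  normc (K_num x n - K_num y n) <= normc (x - y) * (n.+1%:R ^+ 2 * phi ^+ n.+1).
Proof.
move=> x1 y1; rewrite !K_numE; apply: normc_continuantB_le; first exact: normc_ge0.
- by move=> k; rewrite normcX x1 expr1n.
- by move=> k; rewrite normcX y1 expr1n.
move=> k; apply: (le_trans (normc_exprB_le _ x1 y1)).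
by rewrite ler_wpM2r ?normc_ge0 // ler_nat; lia.
Qed.

Lemma K_den_lip x y n : normc x = 1 -> normc y = 1 ->
  normc (K_den x n - K_den y n) <= normc (x - y) * (n%:R ^+ 2 * phi ^+ n).
Proof.
move=> x1 y1; rewrite !K_denE; apply: normc_continuantB_le; first exact: normc_ge0.
- by move=> k; rewrite normcX x1 expr1n.
- by move=> k; rewrite normcX y1 expr1n.
exact: (fun k => normc_exprB_le k.+2 x1 y1).
Qed.

(** The hypothesis is calibrated on the Lipschitz constants at n = q - 1, so the
    bound 2 at exp(2 pi i p/q) deteriorates by a constant only:
    2 * (2 pi) <= 16 comes from the Lipschitz constant 2 of [cis]. *)
Lemma K_bounds_near (t : R) (p q : nat) : (1 < q)%N -> coprime p q ->
  `|t - p%:R / q%:R| * (q%:R ^+ 2 * phi ^+ q) <= 1 ->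
  let y := cis (2 * pi * t) in
  [/\ normc (K_num y q.-1) <= 18, normc (K_num y q.-2) <= 18,
      normc (K_den y q.-1) <= 18 & normc (K_den y q.-2) <= 18].
Proof.
move=> q_gt1 pq tpq y; pose x : R[i] := cis (2 * pi * (p%:R / q%:R)).
have y1 : normc y = 1 := normc_cis _.
have x1 : normc x = 1 := normc_cis _.
have p1 := golden_ratio_gt1.
have p0 : 0 < phi by rewrite (lt_trans _ p1).
have xy : normc (y - x) * (q%:R ^+ 2 * phi ^+ q) <= 16.
  apply: (@le_trans _ _ (16 * (`|t - p%:R / q%:R| * (q%:R ^+ 2 * phi ^+ q)))); last by lra.
  rewrite mulrA ler_wpM2r //; first by rewrite mulr_ge0 // exprn_ge0 // ltW.
  rewrite (le_trans (lip_cis _ _)) // -mulrBr normrM ger0_norm ?mulr_ge0 ?pi_ge0 //.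
  have := pihalf_lt2 R; have := normr_ge0 (t - p%:R / q%:R); nra.
have step (n : nat) : (n <= q)%N -> normc (y - x) * (n%:R ^+ 2 * phi ^+ n) <= 16.
  move=> nq; apply: le_trans xy; rewrite ler_wpM2l ?normc_ge0 //.
  by rewrite ler_pM ?exprn_ge0 // ?(ltW p0) ?lerXn2r ?nnegrE ?ler_nat // ler_weXn2l // ltW.
have bnd (z w : R[i]) : normc w <= 2 -> normc (z - w) <= 16 -> normc z <= 18.
  by move=> hw hz; rewrite -[z](subrK w) (le_trans (ler_normcD _ _)) //; lra.
have [|] := @K_bounds_prim_root (2 * pi * (p%:R / q%:R)) q.-2.
  by rewrite -subn2 -[_.+2]addn2 subnK //; apply: cis_prim_root => //; exact: ltnW.
rewrite -/x (_ : q.-2.+1 = q.-1); last by lia.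
move=> b1 b2 b3 b4; split.
- apply: (bnd _ _ b1); apply: (le_trans (K_num_lip _ y1 x1)); apply: step; lia.
- apply: (bnd _ _ b2); apply: (le_trans (K_num_lip _ y1 x1)); apply: step; lia.
- apply: (bnd _ _ b3); apply: (le_trans (K_den_lip _ y1 x1)); apply: step; lia.
- apply: (bnd _ _ b4); apply: (le_trans (K_den_lip _ y1 x1)); apply: step; lia.
Qed.
End rr.

(** * A criterion for divergence *)

Section divergence.
Variable R : realType.
Implicit Types (a b : R) (x y z w : R[i]).

Lemma nbhs_normc (l : R[i]^o) (e : R) : 0 < e ->
  nbhs l [set z | normc (l - z) < e].
Proof.
move=> e0; apply/nbhs_ballP; exists e%:C => /=; first by rewrite ltcR.
move=> z /=; rewrite /ball /= /ball_ -ltcR; exact.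
Qed.

Lemma nbhs_normcP (l : R[i]^o) (A : set R[i]^o) : nbhs l A ->
  exists2 e : R, 0 < e & forall z, normc (l - z) < e -> A z.
Proof.
move=> /nbhs_ballP[e /= e0 eA]; exists (complex.Re e).
  by move: e0; rewrite ltcE => /andP[].
move=> z lz; apply: eA; rewrite /ball /= /ball_.
have -> : e = (complex.Re e)%:C by apply/esym/RRe_real/gtr0_real.
by rewrite -ltcR in lz.
Qed.

Lemma continuous_Complex : continuous (fun p : R * R => (p.1 +i* p.2 : R[i]^o)).
Proof.
move=> [a b] A /nbhs_normcP[e e0 eA].
have e2 : 0 < e / 2 by rewrite divr_gt0.
exists (ball a (e / 2), ball b (e / 2)); first by split; exact: nbhsx_ballx.
move=> [c d] [/= ac bd]; apply: eA.
rewrite (le_lt_trans (normc_le_ReIm _)) //= (splitr e) ltrD //.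
Qed.

(** A closed square, as the image of a compact subset of R * R: the
    neighbourhoods of infinity are complements of compact sets. *)
Lemma compact_normc_le (r : R) : exists C : set R[i]^o,
  [/\ compact C, closed C & forall z, normc z <= r -> C z].
Proof.
pose C : set R[i]^o := (fun p : R * R => p.1 +i* p.2) @` (`[- r, r] `*` `[- r, r]).
have cC : compact C.
  apply: continuous_compact; last by apply: compact_setX; exact: segment_compact.
  by apply: continuous_subspaceT; exact: continuous_Complex.
exists C; split=> //; first by apply: compact_closed => //; exact: norm_hausdorff.
move=> [a b] zr; exists (a, b) => //=.
have r0 : 0 <= r := le_trans (normc_ge0 _) zr.
have : normc (a +i* b) ^+ 2 <= r ^+ 2 by rewrite lerXn2r ?nnegrE ?normc_ge0.
rewrite /= sqr_sqrtr ?addr_ge0 ?sqr_ge0 // => h.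
have ha : a ^+ 2 <= r ^+ 2 by have := sqr_ge0 b; lra.
have hb : b ^+ 2 <= r ^+ 2 by have := sqr_ge0 a; lra.
move: ha hb; rewrite -[a ^+ 2]real_normK ?num_real // -[b ^+ 2]real_normK ?num_real //.
rewrite !ler_pXn2r ?nnegrE // => /ler_normlP[? ?] /ler_normlP[? ?].
by split; rewrite /= in_itv /=; apply/andP; split; lra.
Qed.

(** With a finite limit, two consecutive convergents would come closer
    than 1 / |Q_n Q_(n+1)| >= 1 / M^2.  With the limit infinity, both
    denominators would be so small, compared with the bounded numerators, that
    the determinant could not have modulus 1. *)
Lemma K_diverges_bounded y (M : R) : normc y = 1 ->
  (forall N, exists2 n, (N <= n)%N &
    [/\ normc (K_num y n.+1) <= M, normc (K_num y n) <= M,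
      normc (K_den y n.+1) <= M & normc (K_den y n) <= M]) ->
  K_diverges y.
Proof.
move=> y1 bnd /cvg_ex[l lim].
have M0 : 0 < M.
  have [n _ [b1 b2 b3 b4]] := bnd 0%N.
  rewrite ltNge; apply/negP => M0.
  have z0 z : normc z <= M -> z = 0.
    move=> zM; apply: eq0_normc; apply/eqP.
    by rewrite eq_le normc_ge0 (le_trans zM).
  have := normc_K_det n y1; rewrite (z0 _ b1) (z0 _ b2) !mul0r subr0 normc0.
  by move/esym/eqP; rewrite oner_eq0.
case: l lim => [l|] lim.
- pose e := (2 * M ^+ 2)^-1.
  have e0 : 0 < e by rewrite invr_gt0 mulr_gt0 // exprn_gt0.
  have /lim := one_point_compactification_some_nbhs _ _ (nbhs_normc l e0).
  case=> N _ HN; have [n Nn [b1 b2 b3 b4]] := bnd N.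
  have key k : (N <= k)%N ->
      K_den y k != 0 /\ normc (l - K_num y k / K_den y k) < e.
    by move=> /HN /=; rewrite /K_convergent; case: eqP => [_ []|_ [z zl [<-]]].
  have [d1 zl] := key n.+1 (leq_trans Nn (leqnSn n)).
  have [d2 wl] := key n Nn.
  set z := K_num y n.+1 / _ in zl; set w := K_num y n / _ in wl.
  have det := normc_K_det n y1.
  have zw : normc (z - w) < M ^- 2.
    rewrite (_ : z - w = (l - w) - (l - z)); last by ring.
    rewrite (le_lt_trans (ler_normcB _ _)) //.
    rewrite (_ : M ^- 2 = e + e); first by rewrite ltrD.
    by rewrite [LHS]splitr /e (invfM 2) mulrC.
  have : normc (z - w) * (normc (K_den y n.+1) * normc (K_den y n)) = 1.
    by rewrite -!normcM -det /z /w; congr normc; field; rewrite d1 d2.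
  have : normc (K_den y n.+1) * normc (K_den y n) <= M ^+ 2.
    by rewrite expr2 ler_pM ?normc_ge0.
  have M2 : 0 < M ^+ 2 by rewrite exprn_gt0.
  rewrite -[M ^- 2]div1r ltr_pdivlMr // in zw.
  have := normc_ge0 (z - w); nra.
- pose r := 3 * M ^+ 2.
  have M2 : 0 < M ^+ 2 by rewrite exprn_gt0.
  have [C [cC clC Cr]] := compact_normc_le r.
  have /lim : nbhs (None : riemann_sphere R) ((Some @` (~` C)) `|` [set None]).
    by exists C.
  case=> N _ HN; have [n Nn [b1 b2 b3 b4]] := bnd N.
  have key k : (N <= k)%N -> r * normc (K_den y k) <= normc (K_num y k).
    move=> /HN /=; rewrite /K_convergent.
    case: eqP => [-> _|/eqP dk [[z Cz [zE]]|//]]; first by rewrite normc0 mulr0 normc_ge0.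
    have rz : r < normc z by rewrite ltNge; apply/negP => /Cr.
    have d0 : 0 < normc (K_den y k).
      by rewrite lt_neqAle normc_ge0 eq_sym andbT; apply: contra dk => /eqP/eq0_normc ->.
    by move: rz; rewrite zE normcM normcV ltr_pdivlMr // => /ltW.
  have k1 := key n.+1 (leq_trans Nn (leqnSn n)).
  have k2 := key n Nn.
  have := ler_normcB (K_num y n.+1 * K_den y n) (K_num y n * K_den y n.+1).
  rewrite normc_K_det // !normcM => det.
  have q1 : normc (K_num y n.+1) * normc (K_den y n) <= 3^-1.
    have := normc_ge0 (K_num y n.+1); have := normc_ge0 (K_den y n); rewrite /r in k1 k2; nra.
  have q2 : normc (K_num y n) * normc (K_den y n.+1) <= 3^-1.
    have := normc_ge0 (K_num y n); have := normc_ge0 (K_den y n.+1); rewrite /r in k1 k2; nra.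
  lra.
Qed.
End divergence.

(** * Approximation by regular continued fractions *)

(** The product of the matrices (b, 1; 1, 0), b in s, applied to the column u.
    Started at (1, 0) it gives the numerator and denominator of [finite_cf s],
    started at (0, 1) those of the preceding convergent. *)
Fixpoint cf_pair (s : seq nat) (u : nat * nat) : nat * nat :=
  if s is b :: s' then
    ((b * (cf_pair s' u).1 + (cf_pair s' u).2)%N, (cf_pair s' u).1)
  else u.

Lemma foldr_cf_pair (F : realFieldType) (s : seq nat) (w : F) : 0 < w ->
  [/\ 0 < (cf_pair s (1%N, 0%N)).1%:R * w + (cf_pair s (0%N, 1%N)).1%:R,
      0 < (cf_pair s (1%N, 0%N)).2%:R * w + (cf_pair s (0%N, 1%N)).2%:R &
      foldr (fun b v => b%:R + v^-1) w s =
      ((cf_pair s (1%N, 0%N)).1%:R * w + (cf_pair s (0%N, 1%N)).1%:R) /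
      ((cf_pair s (1%N, 0%N)).2%:R * w + (cf_pair s (0%N, 1%N)).2%:R)].
Proof.
move=> w0; elim: s => [|b s [num0 den0 IHs]] /=.
  by split; rewrite ?mul1r ?mul0r ?addr0 ?add0r ?divr1.
rewrite IHs; move: (cf_pair s (1%N, 0%N)) (cf_pair s (0%N, 1%N)) num0 den0.
move=> [p q] [p' q'] /= num0 den0; rewrite !natrD !natrM.
set n := p%:R * w + p'%:R in num0 *; set d := q%:R * w + q'%:R in den0 *.
have -> : (b%:R * p%:R + q%:R) * w + (b%:R * p'%:R + q'%:R) = b%:R * n + d :> F.
  by rewrite /n /d; ring.
split=> //; first by rewrite ltr_wpDl // mulr_ge0 // ltW.
by field; rewrite !gt_eqF.
Qed.

(** Each matrix (b, 1; 1, 0) has determinant -1. *)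
Lemma cf_pair_det (F : comNzRingType) (s : seq nat) :
  (cf_pair s (1%N, 0%N)).1%:R * (cf_pair s (0%N, 1%N)).2%:R -
  (cf_pair s (0%N, 1%N)).1%:R * (cf_pair s (1%N, 0%N)).2%:R = (-1) ^+ size s :> F.
Proof.
elim: s => [|b s IHs] /=; first by rewrite mul0r subr0 mulr1.
by rewrite exprS -IHs !natrD !natrM; ring.
Qed.

Lemma cf_pair_coprime s :
  coprime (cf_pair s (1%N, 0%N)).2 (cf_pair s (1%N, 0%N)).1.
Proof.
elim: s => [//|b s IHs] /=.
by rewrite /coprime gcdnMDl -/(coprime _ _) coprime_sym.
Qed.

Lemma cf_pair_ge_size s : (0 < size s)%N -> all (leq 1) s ->
  (0 < (cf_pair s (1%N, 0%N)).2 <= (cf_pair s (1%N, 0%N)).1)%N /\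
  (size s <= (cf_pair s (1%N, 0%N)).1)%N.
Proof.
elim: s => [//|b s IHs] _ /= /andP[b0 s0].
case: s IHs s0 => [|c s] IHs s0; first by rewrite /=; lia.
have [] := IHs isT s0; move: (cf_pair (c :: s) _).1 (cf_pair (c :: s) _).2.
by rewrite [size _]/= => p q; nia.
Qed.

(** This covers the empty sequence, whose value 0 is the quotient 1 / 0. *)
Lemma finite_cf_pair s : all (leq 1) s ->
  finite_cf s = (cf_pair s (1%N, 0%N)).1%:R / (cf_pair s (1%N, 0%N)).2%:R.
Proof.
elim: s => [|b s IHs] /=; first by rewrite /finite_cf /= invr0 mulr0.
move=> /andP[b0 s0]; rewrite {1}/finite_cf /= -/(finite_cf s) IHs // natrD natrM.
have : (0 < (cf_pair s (1%N, 0%N)).1)%N.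
  case: s s0 {IHs} => [//|c s] s0.
  by have [/andP[h1 h2] _] := @cf_pair_ge_size (c :: s) isT s0; exact: leq_trans h2.
rewrite -(ltr0n rat) invf_div => p0.
by rewrite mulrDl mulfK // gt_eqF.
Qed.

Section gauss.
Variable R : realType.
Implicit Types t : R.

Lemma gauss_map_itv t : 0 < t < 1 -> irrational t ->
  0 < gauss_map t < 1 /\ irrational (gauss_map t).
Proof.
move=> /andP[t0 t1] ti.
have gi : irrational (gauss_map t).
  rewrite /irrational /= => -[q _ qg]; apply: ti.
  exists (q + (Num.truncn t^-1)%:R)^-1 => //.
  by rewrite fmorphV rmorphD /= qg ratr_nat /gauss_map subrK invrK.
split=> //; have := truncn_itv (_ : 0 <= t^-1); rewrite invr_ge0 ltW // => /(_ isT).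
rewrite /gauss_map => /andP[h1 h2]; apply/andP; split; last by rewrite ltrBlDl natr1.
rewrite lt_neqAle subr_ge0 h1 andbT; apply/eqP => g0; apply: gi.
by exists 0 => //; rewrite rmorph0.
Qed.

Lemma iter_gauss_itv t i : 0 < t < 1 -> irrational t ->
  0 < iter i (@gauss_map R) t < 1 /\ irrational (iter i (@gauss_map R) t).
Proof.
by move=> t01 ti; elim: i => [//|i [IH1 IH2]]; rewrite iterS; exact: gauss_map_itv.
Qed.

Lemma cf_digit_gt0 t i : 0 < t < 1 -> irrational t -> (0 < cf_digit t i.+1)%N.
Proof.
move=> t01 ti; have [/andP[h0 h1] _] := iter_gauss_itv i t01 ti.
by rewrite /= truncn_gt0 invf_ge1 // ltW.
Qed.

Lemma foldr_cf_digit t i :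
  t = foldr (fun b v => b%:R + v^-1) (iter i (@gauss_map R) t)^-1
    (mkseq (cf_digit t) i.+1).
Proof.
elim: i => [|i IHi]; first by rewrite /= invrK add0r.
rewrite mkseqS foldr_rcons {1}IHi; congr foldr.
by rewrite invrK /= /gauss_map [RHS]addrC subrK.
Qed.

(** With s the digits a_1, ..., a_i and w = 1 / t_i, the number t is the Moebius
    image (q w + q') / (p w + p'), so its distance to q / p is
    1 / (p (p w + p')), and w >= a_(i+1). *)
Lemma cf_convergent_approx t i : 0 < t < 1 -> irrational t ->
  exists c : nat, [/\ coprime c (cf_denominator t i), (c <= cf_denominator t i)%N,
    (0 < cf_denominator t i)%N, (i <= cf_denominator t i)%N &
    `|t - c%:R / (cf_denominator t i)%:R| *
      ((cf_denominator t i)%:R ^+ 2 * (cf_digit t i.+1)%:R) <= 1].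
Proof.
move=> t01 ti; set w := (iter i (@gauss_map R) t)^-1.
have [/andP[h0 h1] _] := iter_gauss_itv i t01 ti.
have w0 : 0 < w by rewrite invr_gt0.
pose s := mkseq (fun j => cf_digit t j.+1) i.
have sE : mkseq (cf_digit t) i.+1 = 0%N :: s.
  by rewrite /mkseq /= (iotaDl 1 0) -map_comp.
have s1 : all (leq 1) s by apply/allP => _ /mapP[j _ ->]; exact: cf_digit_gt0.
have ss : size s = i by rewrite size_mkseq.
have tE : t = ((cf_pair s (1%N, 0%N)).1%:R * w + (cf_pair s (0%N, 1%N)).1%:R)^-1 *
    ((cf_pair s (1%N, 0%N)).2%:R * w + (cf_pair s (0%N, 1%N)).2%:R).
  rewrite {1}(foldr_cf_digit t i) -/w sE /=.
  by have [_ _ ->] := foldr_cf_pair s w0; rewrite add0r invf_div mulrC.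
have [num0 _ _] := foldr_cf_pair s w0.
have det := cf_pair_det R s.
have cop := cf_pair_coprime s.
have [p0 qp ip] : [/\ (0 < (cf_pair s (1%N, 0%N)).1)%N,
    ((cf_pair s (1%N, 0%N)).2 <= (cf_pair s (1%N, 0%N)).1)%N &
    (i <= (cf_pair s (1%N, 0%N)).1)%N].
  case: (s) ss s1 => [|c s'] ss s1; first by rewrite -ss.
  have [/andP[h3 h4] h5] := @cf_pair_ge_size (c :: s') isT s1.
  by split=> //; [exact: leq_trans h4 | rewrite -ss].
have dE : cf_denominator t i = (cf_pair s (1%N, 0%N)).1.
  rewrite /cf_denominator /cf_convergent sE /finite_cf /= add0r -/(finite_cf s).
  rewrite finite_cf_pair // invf_div.
  move: cop p0; move: (cf_pair s _).1 (cf_pair s _).2 => p q cop p0.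
  rewrite -[q%:R]/(q%:Z%:~R) -[p%:R]/(p%:Z%:~R) coprimeq_den //.
  by case: p p0 {cop}.
rewrite dE; exists (cf_pair s (1%N, 0%N)).2; split=> //.
move: num0 det tE p0; move: (cf_pair s (1%N, 0%N)) (cf_pair s (0%N, 1%N)) => [p q] [p' q'] /=.
move=> num0 det tE; rewrite -(ltr0n R) => p0.
have aw : (Num.truncn w)%:R <= w by rewrite truncn_le ltW.
have -> : t - q%:R / p%:R = (-1) ^+ size s / (p%:R * (p%:R * w + p'%:R)).
  by rewrite tE -det; field; rewrite !gt_eqF.
rewrite normrM normrX normrN1 expr1n mul1r normfV gtr0_norm ?mulr_gt0 //.
rewrite mulrC ler_pdivrMr ?mulr_gt0 // mul1r expr2 -mulrA ler_pM2l //.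
rewrite mulrC; have := ler0n R p'; have := ler0n R (Num.truncn w); nra.
Qed.

Lemma infinite_nat_ge (P : set nat) N : infinite_set P -> exists2 i, (N <= i)%N & P i.
Proof.
move=> Pinf; apply: contrapT => H; apply: Pinf.
apply: (@sub_finite_set _ _ `I_N); last exact: finite_II.
by move=> i Pi /=; rewrite ltnNge; apply/negP => Ni; apply: H; exists i.
Qed.

(** All that divergence and measure zero need to know about exceptional
    numbers. *)
Lemma exceptional_approx t N : exceptional_set t -> exists q p : nat,
  [/\ (N <= q)%N, coprime p q, (p <= q)%N &
    `|t - p%:R / q%:R| * (q%:R ^+ 2 * golden_ratio R ^+ q) <= 1].
Proof.
move=> [t01 ti tinf]; have [i Ni /= ai] := infinite_nat_ge N tinf.
have [p [cop pq q0 iq h]] := cf_convergent_approx i t01 ti.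
exists (cf_denominator t i), p; split=> //; first exact: leq_trans iq.
by apply: le_trans h; rewrite ler_wpM2l // ler_wpM2l // exprn_ge0.
Qed.
End gauss.

(** * Divergence and measure *)

Section measure_zero.
Variable R : realType.
Local Notation phi := (golden_ratio R).

Lemma K_diverges_exceptional (t : R) : exceptional_set t -> K_diverges (cis (2 * pi * t)).
Proof.
move=> tS; apply: (@K_diverges_bounded _ _ 18); first exact: normc_cis.
move=> N; have [q [p [Nq pq _ h]]] := exceptional_approx N.+2 tS.
have q1 : (1 < q)%N by apply: leq_trans Nq.
have [b1 b2 b3 b4] := K_bounds_near q1 pq h.
exists q.-2; first lia.
by rewrite (_ : q.-2.+1 = q.-1); last lia.
Qed.

Definition fraction_nbhd (q p : nat) : set R :=
  [set` `[p%:R / q%:R - (q%:R ^+ 2 * phi ^+ q)^-1,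
          p%:R / q%:R + (q%:R ^+ 2 * phi ^+ q)^-1]].

Definition near_fractions (q : nat) : set R :=
  \big[setU/set0]_(p < q.+1) fraction_nbhd q p.

Lemma measurable_near_fractions q : measurable (near_fractions q).
Proof. by apply: bigsetU_measurable => p _; exact: measurable_itv. Qed.

Lemma near_fractions_le q :
  (lebesgue_measure (near_fractions q) <= (geometric 4 phi^-1 q)%:E)%E.
Proof.
have phi0 : 0 < phi by rewrite (lt_trans _ (golden_ratio_gt1 R)).
set r := (q%:R ^+ 2 * phi ^+ q)^-1.
have r0 : 0 <= r by rewrite invr_ge0 mulr_ge0 // exprn_ge0 // ltW.
have mu_nbhd p : lebesgue_measure (fraction_nbhd q p) = (2 * r)%:E.
  rewrite /fraction_nbhd -/r lebesgue_measure_itv /= lte_fin; case: ltP => h.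
    by rewrite -EFinB; congr EFin; ring.
  by congr EFin; lra.
have := @Boole_inequality _ _ _ (@lebesgue_measure R) (fraction_nbhd q) q.+1
  (fun p _ => measurable_itv _).
move=> /le_trans; apply.
rewrite (eq_bigr (fun=> (2 * r)%:E)); last by move=> i _; exact: mu_nbhd.
rewrite sumEFin lee_fin sumr_const card_ord -[(2 * r) *+ _]mulr_natr /r /= exprVn.
have f0 : 0 <= (phi ^+ q)^-1 by rewrite invr_ge0 exprn_ge0 // ltW.
have g2 : (q%:R ^+ 2)^-1 * q.+1%:R <= 2 :> R.
  have [->|q0] := posnP q; first by rewrite expr2 mul0r invr0 mul0r.
  have q1 : (1 : R) <= q%:R by rewrite ler1n.
  by rewrite mulrC ler_pdivrMr ?exprn_gt0 ?(lt_le_trans ltr01) // -natr1; nra.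
rewrite [(_ * phi ^+ q)^-1]invfM; move: (phi ^+ q)^-1 (q%:R ^+ 2)^-1 f0 g2 => f g f0 g2.
by nra.
Qed.

Lemma negligible_exceptional_set : lebesgue_measure.-negligible (@exceptional_set R).
Proof.
exists (lim_sup_set near_fractions); split.
- apply: bigcap_measurable => // n _; apply: bigcup_measurable => k _.
  exact: measurable_near_fractions.
- apply: lim_sup_set_cvg0; first exact: measurable_near_fractions.
  have p1 := golden_ratio_gt1 R; have p0 : 0 < phi by rewrite (lt_trans _ p1).
  apply: (@le_lt_trans _ _ (4 * (1 - phi^-1)^-1)%:E); last exact: ltry.
  apply: lime_le; first by apply: is_cvg_nneseries => *; exact: measure_ge0.
  apply: nearW => n; apply: (@le_trans _ _ (\sum_(0 <= i < n) (geometric 4 phi^-1 i)%:E)%E).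
    by apply: lee_sum => i _; exact: near_fractions_le.
  rewrite sumEFin lee_fin; apply: geometric_le_lim => //; first by rewrite invr_gt0.
  by rewrite gtr0_norm ?invr_gt0 // invf_lt1.
move=> t tS N _; have [q [p [Nq pq pq' h]]] := exceptional_approx N.+1 tS.
exists q; first exact: ltnW.
rewrite /near_fractions -bigcup_mkord; exists p => //=.
have phi0 : 0 < phi by rewrite (lt_trans _ (golden_ratio_gt1 R)).
have r0 : 0 < q%:R ^+ 2 * phi ^+ q.
  by rewrite mulr_gt0 ?exprn_gt0 // ltr0n; apply: leq_trans Nq.
move: h; rewrite -ler_pdivlMr // div1r => /ler_normlP[h1 h2].
by rewrite /fraction_nbhd /= in_itv /=; apply/andP; split; lra.
Qed.
End measure_zero.

(** * Numbers with prescribed digits *)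

Section uncountable.
Variable R : realType.
Implicit Types (t : R) (a : nat -> nat).

(** The end points of the set of numbers [0, a_0, ..., a_(n-1) + u] with u
    in [0, 1].  Reciprocals exchange the end points. *)
Fixpoint cylinder a (n : nat) : R * R :=
  if n is m.+1 then
    (((a 0%N)%:R + (cylinder (fun k => a k.+1) m).2)^-1,
     ((a 0%N)%:R + (cylinder (fun k => a k.+1) m).1)^-1)
  else (0, 1).

Lemma cylinderS a n : cylinder a n.+1 =
  (((a 0%N)%:R + (cylinder (fun k => a k.+1) n).2)^-1,
   ((a 0%N)%:R + (cylinder (fun k => a k.+1) n).1)^-1).
Proof. by []. Qed.

Definition in_cylinders a t := forall n, (cylinder a n).1 <= t <= (cylinder a n).2.

Lemma cylinder_nested a n : (forall k, 0 < a k)%N ->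
  [/\ 0 <= (cylinder a n).1, (cylinder a n).1 <= (cylinder a n.+1).1,
      (cylinder a n.+1).1 <= (cylinder a n.+1).2,
      (cylinder a n.+1).2 <= (cylinder a n).2 & (cylinder a n).2 <= 1].
Proof.
elim: n a => [|n IHn] a a0.
  have a1 : 1 <= (a 0%N)%:R :> R by rewrite ler1n.
  rewrite /= addr0; split=> //; first by rewrite lef_pV2 ?posrE //; lra.
  by rewrite invf_le1 //; lra.
have a1 : 1 <= (a 0%N)%:R :> R by rewrite ler1n.
have := IHn (fun k => a k.+1) (fun k => a0 k.+1).
rewrite (cylinderS a n.+1) (cylinderS a n).
move: (cylinder _ n.+1) (cylinder _ n) => [l1 h1] [l h] /= [l0 ll lh hh h1'].
split; rewrite ?lef_pV2 ?posrE ?invr_ge0 ?invf_le1 //; lra.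
Qed.

Lemma in_cylinders_ex a : (forall k, 0 < a k)%N -> exists t, in_cylinders a t.
Proof.
move=> a0; pose lo n := (cylinder a n).1; pose hi n := (cylinder a n).2.
have lo_mono : {homo lo : m n / (m <= n)%N >-> m <= n}.
  by apply: homo_leq => // [|n]; [exact: le_trans | have [] := cylinder_nested n a0].
have hi_mono : {homo hi : m n / (m <= n)%N >-> n <= m}.
  apply: (homo_leq (r := fun x y => y <= x)) => // [x y z xy yz|n].
    exact: le_trans yz xy.
  by have [] := cylinder_nested n a0.
have lohi m n : lo m <= hi n.
  apply: (@le_trans _ _ (lo (maxn m n).+1)).
    by apply: lo_mono; rewrite ltnW // ltnS leq_maxl.
  apply: (@le_trans _ _ (hi (maxn m n).+1)); first by have [] := cylinder_nested (maxn m n) a0.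
  by apply: hi_mono; rewrite ltnW // ltnS leq_maxr.
exists (sup (range lo)) => n; apply/andP; split.
  apply: ub_le_sup; last by exists n.
  by exists (hi 0%N) => _ [m _ <-].
by apply: ge_sup; [exists (lo 0%N); exists 0%N | move=> _ [m _ <-]; exact: lohi].
Qed.

Lemma in_cylinders_shift a t : (forall k, 0 < a k)%N -> in_cylinders a t ->
  0 < t /\ in_cylinders (fun k => a k.+1) (t^-1 - (a 0%N)%:R).
Proof.
move=> a0 at_; have a1 : 1 <= (a 0%N)%:R :> R by rewrite ler1n.
have t0 : 0 < t.
  have /andP[h _] := at_ 1%N; apply: lt_le_trans h => /=.
  by rewrite invr_gt0; lra.
split=> // n; have /= := at_ n.+1.
have [] := cylinder_nested n (fun k => a0 k.+1).
have [] := cylinder_nested n.+1 (fun k => a0 k.+1).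
move: (cylinder _ n.+2) (cylinder _ n.+1) (cylinder _ n) => [l2 h2] [l1 h1] [l h] /=.
move=> _ _ _ _ _ l0 ll lh hh _ /andP[h3 h4].
apply/andP; split.
  by rewrite lerBrDl -[_ + l]invrK lef_pV2 ?posrE ?invr_gt0 //; lra.
by rewrite lerBlDl -[_ + h]invrK lef_pV2 ?posrE ?invr_gt0 //; lra.
Qed.

Lemma in_cylinders_itv a t : (forall k, 0 < a k)%N -> in_cylinders a t ->
  0 < t < 1 /\ 0 < t^-1 - (a 0%N)%:R < 1.
Proof.
have lt1 b s : (forall k, 0 < b k)%N -> in_cylinders b s -> 0 < s < 1.
  move=> b0 bs; have [s0 bs1] := in_cylinders_shift b0 bs.
  have [u0 _] := in_cylinders_shift (fun k => b0 k.+1) bs1.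
  rewrite s0 /= -invf_gt1 //.
  have : 1 <= (b 0%N)%:R :> R by rewrite ler1n.
  by lra.
move=> a0 at_; split; first exact: lt1 at_.
have [_ at1] := in_cylinders_shift a0 at_.
by apply: lt1 at1 => k; exact: a0.
Qed.

Lemma in_cylinders_gauss a t : (forall k, 0 < a k)%N -> in_cylinders a t ->
  Num.truncn t^-1 = a 0%N /\ in_cylinders (fun k => a k.+1) (gauss_map t).
Proof.
move=> a0 at_; have [_ /andP[u0 u1]] := in_cylinders_itv a0 at_.
have tr : Num.truncn t^-1 = a 0%N.
  by apply: truncn_def; rewrite -natr1; apply/andP; split; lra.
by split=> //; rewrite /gauss_map tr; have [] := in_cylinders_shift a0 at_.
Qed.

Lemma in_cylinders_iter a t i : (forall k, 0 < a k)%N -> in_cylinders a t ->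
  in_cylinders (fun k => a (i + k)%N) (iter i (@gauss_map R) t).
Proof.
move=> a0 at_; elim: i => [//|i IHi]; rewrite iterS.
have [_] := in_cylinders_gauss (fun k => a0 (i + k)%N) IHi.
by under [X in in_cylinders X _ -> _]eq_fun do rewrite addnS -addSn.
Qed.

Lemma in_cylinders_digit a t i : (forall k, 0 < a k)%N -> in_cylinders a t ->
  cf_digit t i.+1 = a i.
Proof.
move=> a0 at_; have := in_cylinders_iter i a0 at_.
by move/(in_cylinders_gauss (fun k => a0 (i + k)%N)) => [tr _]; rewrite [LHS]tr addn0.
Qed.

(** Infinite descent: if t = c / d then the next complete quotient gives
    (d - a_0 c) / c, again in all cylinders and with a smaller numerator. *)
Lemma in_cylinders_neq_frac a t (c d : nat) : (forall k, 0 < a k)%N ->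
  in_cylinders a t -> t <> c%:R / d%:R.
Proof.
have [n] := ubnP c; elim: n => [//|n IHn] in a t c d *; rewrite ltnS => cn a0 at_ tE.
have [/andP[t0 t1] /andP[u0 u1]] := in_cylinders_itv a0 at_.
have [_ at1] := in_cylinders_shift a0 at_.
have [c0 d0] : (0 < c)%N /\ (0 < d)%N.
  split; rewrite lt0n; apply/eqP => h; move: t0; rewrite tE h ?mul0r ?invr0 ?mulr0 ltxx //.
have c0' : 0 < c%:R :> R by rewrite ltr0n.
have uE : t^-1 - (a 0%N)%:R = (d%:R - (a 0%N * c)%:R) / c%:R.
  by rewrite tE natrM; field; rewrite !gt_eqF // ltr0n.
have ad : (a 0 * c <= d)%N.
  rewrite -(ler_nat R) -subr_ge0 ltW // -(pmulr_lgt0 _ (_ : 0 < c%:R^-1)) ?invr_gt0 //.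
  by rewrite -uE.
rewrite -natrB // in uE.
apply: (IHn _ _ (d - a 0 * c)%N c _ (fun k => a0 k.+1) at1 uE).
apply: leq_trans cn; rewrite -(ltr_nat R) -(ltr_pM2r (_ : 0 < c%:R^-1)) ?invr_gt0 //.
by rewrite -uE mulfV // gt_eqF.
Qed.

Lemma in_cylinders_irrational a t : (forall k, 0 < a k)%N -> in_cylinders a t ->
  irrational t.
Proof.
move=> a0 at_ /rationalP[[c|c] [d tE]]; first exact: (in_cylinders_neq_frac a0 at_ tE).
have [/andP[t0 _] _] := in_cylinders_itv a0 at_.
move: t0; rewrite tE NegzE mulrNz mulNr oppr_gt0 ltNge => /negP; apply.
by rewrite divr_ge0.
Qed.

(** A digit to be appended to s: the first summand makes it exceed phi^d,
    with d the denominator reached so far; the second makes it differ from the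
    digit at the same place of the number with index [size s]. *)
Definition diagonal_digit (f : nat -> R) (s : seq nat) : nat :=
  (Num.truncn (golden_ratio R ^+ `|denq (finite_cf (0%N :: s))|%N)).+1
  + cf_digit (f (size s)) (size s).+1.

Fixpoint diagonal_digits (f : nat -> R) (n : nat) : seq nat :=
  if n is m.+1 then
    rcons (diagonal_digits f m) (diagonal_digit f (diagonal_digits f m))
  else [::].

Lemma diagonal_digitsE f n :
  diagonal_digits f n = mkseq (fun k => diagonal_digit f (diagonal_digits f k)) n.
Proof. by elim: n => [//|n IHn]; rewrite mkseqS -IHn. Qed.

Lemma uncountable_exceptional_set : ~ countable (@exceptional_set R).
Proof.
move=> /pcard_surjP[f fS].
pose a n := diagonal_digit f (diagonal_digits f n).
have a0 n : (0 < a n)%N by rewrite /a /diagonal_digit addSn.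
have [t at_] := in_cylinders_ex a0.
have digE i : cf_digit t i.+1 = a i := in_cylinders_digit i a0 at_.
have szE n : size (diagonal_digits f n) = n by rewrite diagonal_digitsE size_mkseq.
have tS : exceptional_set t.
  split; [by have [] := in_cylinders_itv a0 at_ | exact: in_cylinders_irrational at_ |].
  rewrite (_ : [set i | _] = setT); first exact: infinite_nat.
  apply/seteqP; split=> // i _ /=; rewrite -/(cf_digit t i.+1) digE.
  have -> : cf_denominator t i = `|denq (finite_cf (0%N :: diagonal_digits f i))|%N.
    rewrite /cf_denominator /cf_convergent; do 3!congr (_ _).
    rewrite diagonal_digitsE /mkseq /= (iotaDl 1 0) -map_comp; congr cons.
    by apply: eq_map => k; exact: digE.
  rewrite /a /diagonal_digit natrD; set x := _ ^+ _.
  by rewrite (le_trans (ltW (truncnS_gt x))) // lerDl.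
have [n _ ft] := fS t tS.
have := digE n; rewrite -ft /a /diagonal_digit szE => /eqP.
by rewrite addSn -[X in X == _]add0n -addSn eqn_add2r.
Qed.
End uncountable.

Theorem theorem1 (R : realType) :
  [/\ ~ countable (@exceptional_set R),
      lebesgue_measure.-negligible (@exceptional_set R) &
      forall t : R, exceptional_set t ->
        K_diverges (cexp ((2 * pi * t)%:C * 'i%C))].
Proof.
split; [exact: uncountable_exceptional_set | exact: negligible_exceptional_set |].
by move=> t tS; rewrite cexp_cis; exact: K_diverges_exceptional.
Qed.
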